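(* Let $G$ be a group, $T=\{n_\gamma\}_{\gamma<o(T)}$ a type of relational systems, and $(\theta,\mathcal A)\in \mathsf{pA}(G,\mathsf R(T))$, where $\mathcal A=(A,\{(\rho_\gamma)_{\mathcal A}\}_{\gamma<o(T)})$. Define $\mathcal A^U$ to be the relational system of type $T$ on the set $A^U$ with $$(\rho_\gamma)_{\mathcal A^U}=\{([x,a_1],\dots,[x,a_{n_\gamma}])\mid (a_1,\dots,a_{n_\gamma})\in(\rho_\gamma)_{\mathcal A},\ x\in G\}.$$ Then $(\theta^U,\mathcal A^U)$, with the map $a\mapsto[1,a]$, is a universal globalization of $(\theta,\mathcal A)$ in $\mathsf A(G,\mathsf R(T))$. Moreover, $(\theta^U,\mathcal A^U)$ is an $\mathsf A(G,\mathsf R(T))$-reflector of $(\theta,\mathcal A)$, with reflector morphism $a\mapsto[1,a]$.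
   Context: Partial actions. A partial action of a group $G$ on a set $A$ is a partial map $\theta:G\times A\dashrightarrow A$ such that for all $x,y\in G$, $a\in A$: (i) $\theta(1,a)$ is defined and equals $a$; (ii) if $\theta(x,a)$ is defined, then $\theta(x^{-1},\theta(x,a))$ is defined and equals $a$; (iii) if $\theta(y,a)$ and $\theta(x,\theta(y,a))$ are defined, then $\theta(xy,a)$ is defined and equals $\theta(x,\theta(y,a))$. It is global if it is everywhere defined. One writes $xa$ for $\theta(x,a)$ and $xa\neq\varnothing$ for ''$xa$ is defined''. A morphism of partial actions $(\theta,A)\to(\theta',A')$ is a map $\varphi:A\to A'$ such that $xa\neq\varnothing$ implies that $x\varphi(a)$ is defined and equals $\varphi(xa)$. Relational systems. A type is a sequence $T=\{n_\gamma\}_{\gamma<o(T)}$ of positive integers indexed by ordinals. A relational system of type $T$ is a set $A$ with an $n_\gamma$-ary relation $(\rho_\gamma)_{\mathcal A}\subseteq A^{n_\gamma}$ for each $\gamma<o(T)$; a morphism $\mathcal A\to\mathcal A'$ is a map $A\to A'$ sending tuples in $(\rho_\gamma)_{\mathcal A}$ to tuples in $(\rho_\gamma)_{\mathcal A'}$ for all $\gamma$. A partial action of $G$ on $\mathcal A$ is a partial action of $G$ on the set $A$ such that whenever $(a_1,\dots,a_{n_\gamma})\in\rho_\gamma$ and $xa_1,\dots,xa_{n_\gamma}$ are all defined, then $(xa_1,\dots,xa_{n_\gamma})\in\rho_\gamma$. The category $\mathsf{pA}(G,\mathsf R(T))$ has as objects the pairs $(\theta,\mathcal A)$ with $\theta$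 a partial action of $G$ on a relational system $\mathcal A$ of type $T$; its morphisms are the maps which are both morphisms of relational systems and of partial actions. $\mathsf A(G,\mathsf R(T))$ is the full subcategory of pairs with global $\theta$. Globalization. A globalization of $(\theta,\mathcal A)$ in $\mathsf A(G,\mathsf R(T))$ is $(\vartheta,\mathcal B)\in\mathsf A(G,\mathsf R(T))$ with an injective morphism $\iota:(\theta,\mathcal A)\to(\vartheta,\mathcal B)$ such that (1) for all $x\in G$, $a\in A$: $xa\neq\varnothing\iff x\iota(a)\in\iota(A)$; (2) $(\iota(a_1),\dots,\iota(a_{n_\gamma}))\in(\rho_\gamma)_{\mathcal B}$ implies $(a_1,\dots,a_{n_\gamma})\in(\rho_\gamma)_{\mathcal A}$. It is universal if for any globalization $\iota':(\theta,\mathcal A)\to(\vartheta',\mathcal B')$ in $\mathsf A(G,\mathsf R(T))$ there is a unique morphism $\kappa:(\vartheta,\mathcal B)\to(\vartheta',\mathcal B')$ with $\iota'=\kappa\circ\iota$. The set $A^U$. $A^U=(G\times A)/{\sim}$, where $(x,a)\sim(y,b)$ iff $(y^{-1}x)a$ is defined and equals $b$; $[x,a]$ is the class of $(x,a)$; $\theta^U$ is the global action $x[y,a]=[xy,a]$ of $G$ on $A^U$. Reflector. For a subcategory $\mathsf D$ of $\mathsf C$, a $\mathsf D$-reflector of $C\in\mathsf C$ is an object $R\in\mathsf D$ with a morphism $\varepsilon:C\to R$ (reflector morphism) such that for every $D\in\mathsf D$ and every $\varphi:C\to D$ there is a unique $\psi:R\to D$ in $\mathsf D$ with $\psi\circ\varepsilon=\varphi$.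 *)

(* Defs.v *)
From mathcomp Require Import all_boot.
From mathcomp Require Import boolp classical_sets wochoice.

Set Implicit Arguments.
Unset Strict Implicit.
Unset Printing Implicit Defensive.

Local Open Scope classical_set_scope.
Local Open Scope group_scope.

(* The ordinals below o(T) are represented by a well-ordered index type. *)
Record rel_type := RelType {
  rel_index : Type;
  rel_index_le : rel rel_index;
  rel_index_wo : well_order rel_index_le;
  arity : rel_index -> nat;
  arity_gt0 : forall g, (0 < arity g)%N }.

Record rel_system (T : rel_type) := RelSystem {
  carrier :> Type;
  rho : forall g : rel_index T, set ((arity g).-tuple carrier) }.

Definition rel_morphism (T : rel_type) (A B : rel_system T) (f : A -> B) :=
  forall (g : rel_index T) (t : (arity g).-tuple A),
    rho t -> rho (map_tuple f t).

(* A partial map G * A -> A is a function theta : G -> A -> option A, with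
   theta x a = None when "x a" is undefined. *)
Record partial_action (G : groupType) (A : Type) (theta : G -> A -> option A) :
    Prop := PartialAction {
  pact1 : forall a, theta 1 a = Some a;
  pactV : forall x a b, theta x a = Some b -> theta x^-1 b = Some a;
  pactM : forall x y a b c,
    theta y a = Some b -> theta x b = Some c -> theta (x * y) a = Some c }.

Definition global (G : groupType) (A : Type) (theta : G -> A -> option A) :=
  forall x a, theta x a <> None.

Definition pact_morphism (G : groupType) (A B : Type)
    (theta : G -> A -> option A) (theta' : G -> B -> option B) (f : A -> B) :=
  forall x a b, theta x a = Some b -> theta' x (f a) = Some (f b).

(* Data underlying an object of pA(G, R(T)); the axioms are in_pA. *)
Record act_system (G : groupType) (T : rel_type) := ActSystem {
  system :> rel_system T;
  act : G -> system -> option system }.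

Section Categories.
Context (G : groupType) (T : rel_type).
Implicit Types B C D R : act_system G T.

Definition in_pA C :=
  partial_action (@act _ _ C) /\
  forall (x : G) (g : rel_index T) (t s : (arity g).-tuple C), rho t ->
    (forall i, act x (tnth t i) = Some (tnth s i)) -> rho s.

Definition in_A C := in_pA C /\ global (@act _ _ C).

(* The morphisms of pA(G, R(T)), hence also of its full subcategory
   A(G, R(T)). *)
Definition morphism C B (f : C -> B) :=
  rel_morphism f /\ pact_morphism (@act _ _ C) (@act _ _ B) f.

Record globalization C B (iota : C -> B) : Prop := Globalization {
  glob_in_A : in_A B;
  glob_morphism : morphism iota;
  glob_inj : injective iota;
  glob_act : forall x a,
    act x a <> None <-> exists a', act x (iota a) = Some (iota a');
  glob_rho : forall (g : rel_index T) (t : (arity g).-tuple C),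
    rho (map_tuple iota t) -> rho t }.

Definition universal_globalization C B (iota : C -> B) :=
  globalization iota /\
  forall B' (iota' : C -> B'), globalization iota' ->
    exists! kappa : B -> B', morphism kappa /\ iota' = kappa \o iota.

(* Reflectors of objects of pA(G, R(T)) in the subcategory A(G, R(T)). *)
Definition reflector C R (eps : C -> R) :=
  [/\ in_A R, morphism eps &
    forall D (phi : C -> D), in_A D -> morphism phi ->
      exists! psi : R -> D, morphism psi /\ psi \o eps = phi].

End Categories.

Arguments universal_globalization {G T} C B iota.
Arguments reflector {G T} C R eps.

Section UniversalGlobalization.
Context (G : groupType).

Section Carrier.
Context (A : Type) (theta : G -> A -> option A).

Definition simU (p q : G * A) := theta (q.1^-1 * p.1) p.2 = Some q.2.

Definition classU (p : G * A) : set (G * A) := [set q | simU p q].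

(* A^U = (G * A) / simU, as the type of equivalence classes. *)
Definition AU := {X : set (G * A) | exists p, X = classU p}.

(* The class [x, a]. *)
Definition clsU (x : G) (a : A) : AU :=
  exist _ (classU (x, a)) (ex_intro _ (x, a) erefl).

Lemma simU_equiv : partial_action theta ->
  [/\ forall p, simU p p, forall p q, simU p q -> simU q p &
      forall p q r, simU p q -> simU q r -> simU p r].
Proof.
case=> th1 thV thM; rewrite /simU; split=> [p|p q /thV|p q r pq qr].
- by rewrite mulVg th1.
- by rewrite invgM invgK.
- by rewrite -(thM _ _ _ _ _ pq qr) -!mulgA mulVKg.
Qed.

Lemma eq_clsU : partial_action theta -> forall x a y b,
  clsU x a = clsU y b <-> simU (x, a) (y, b).
Proof.
move=> /simU_equiv[sim_refl sim_sym sim_trans] x a y b; split=> [|ab].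
  move=> /(congr1 (@sval _ _))/= e.
  by rewrite -[simU _ _]/(classU _ _) e; apply: sim_refl.
by apply: eq_exist; apply/seteqP; split=> q /=; apply: sim_trans => //; apply: sim_sym.
Qed.

(* The translate x X of a class X, as the preimage of X under the left
   translation by x^-1; see translate_clsU. *)
Fact translate_subproof (x : G) (X : AU) :
  exists p, [set q : G * A | sval X (x^-1 * q.1, q.2)] = classU p.
Proof.
case: X => X [[y a] eX] /=; exists (x * y, a); rewrite eX.
by apply/seteqP; split=> -[z b]; rewrite /classU /simU /= invgM invgK mulgA.
Qed.

Definition translate (x : G) (X : AU) : AU := exist _ _ (translate_subproof x X).

Lemma translate_clsU x y a : translate x (clsU y a) = clsU (x * y) a.
Proof.
apply: eq_exist; apply/seteqP.
by split=> -[z b] /=; rewrite /classU /simU /= invgM invgK mulgA.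
Qed.

Definition thetaU (x : G) (X : AU) : option AU := Some (translate x X).

End Carrier.

Context (T : rel_type).

Definition systemU (A : rel_system T) (theta : G -> A -> option A) :
    rel_system T :=
  @RelSystem T (AU theta) (fun g =>
    [set s | exists x (a : (arity g).-tuple A),
               rho a /\ s = map_tuple (clsU theta x) a]).

Definition act_systemU (C : act_system G T) : act_system G T :=
  @ActSystem G T (systemU (@act _ _ C)) (@thetaU C (@act _ _ C)).

Definition iotaU (C : act_system G T) : C -> act_systemU C :=
  clsU (@act _ _ C) 1.

End UniversalGlobalization.

Arguments iotaU {G T} C _.

(* Main.v *)
Require Import Defs.
From mathcomp Require Import all_boot.
From mathcomp Require Import boolp.

(** Both claims come from one universal property.  Every element of [AU] is a
    translate [x, a] = x [1, a] of a point of the image of iota = [1, _], so an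
    equivariant map psi out of [AU] with psi \o iota = phi can only be
    psi [x, a] = x (phi a).  This formula is independent of the representative:
    [x, a] = [y, b] says (y^-1 x) a = b, which the morphism phi carries to
    (y^-1 x) (phi a) = phi b in a global action, that is
    x (phi a) = y (phi b).  It also preserves the relations, because those of
    [AU] are by construction the translates of the images of those of A.  This
    gives the reflector property ([reflector_iotaU]), and universality among
    globalizations is its restriction to the injective morphisms that are
    globalizations.

    It remains that iota is itself a globalization ([globalization_iotaU]).
    Injectivity, equivariance and the two reflection conditions reduce to
    [iotaU_clsU_eq]: [1, a] = [x, b] exactly when x b is defined and equals a.  In particular, if the tuple ([1, a_i]) is
    related in [AU], say [1, a_i] = [x, b_i] with (b_i) related in A, then
    a_i = x b_i, so (a_i) is related since the partial action respects the
    relations; this is where the compatibility of theta with the relations of A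
    enters. *)

Set Implicit Arguments.
Unset Strict Implicit.
Unset Printing Implicit Defensive.

Local Open Scope group_scope.

Lemma AU_clsU (G : groupType) (A : Type) (theta : G -> A -> option A)
    (X : AU theta) : exists x a, X = clsU theta x a.
Proof.
case: X => X [[x a] eX]; exists x, a.
by apply: eq_exist.
Qed.

Section Objects.
Context (G : groupType) (T : rel_type) (C : act_system G T) (hC : in_pA C).

Let thP : partial_action (@act _ _ C) := hC.1.

Lemma iotaU_clsU_eq (x : G) (a b : C) :
  iotaU C a = clsU (@act _ _ C) x b <-> act x b = Some a.
Proof.
rewrite (eq_clsU thP) /simU /= mulg1.
by split=> /(pactV thP); rewrite ?invgK.
Qed.

Lemma iotaU_inj : injective (iotaU C).
Proof. by move=> a b /iotaU_clsU_eq; rewrite (pact1 thP) => -[]. Qed.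

(** Hence [AU] is the union of the orbits of the points iota a, and an
    equivariant map out of it is determined by its values at these points. *)
Lemma act_iotaU (x : G) (a : C) :
  act x (iotaU C a) = Some (clsU (@act _ _ C) x a).
Proof. by rewrite /= /thetaU translate_clsU mulg1. Qed.

Lemma in_A_act_systemU : in_A (act_systemU C).
Proof.
split; last by [].
split=> [|x g t s [y [a [ra ->]]] ts].
  split=> [X|x X _ [<-]|x y X _ _ [<-] [<-]]; rewrite /= /thetaU.
  - by have [y [a ->]] := AU_clsU X; rewrite translate_clsU mul1g.
  - by have [y [a ->]] := AU_clsU X; rewrite !translate_clsU mulKg.
  - by have [z [a ->]] := AU_clsU X; rewrite !translate_clsU mulgA.
exists (x * y), a; split=> //; apply: eq_from_tnth => i.
by have := ts i; rewrite !tnth_map /= /thetaU translate_clsU => -[].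
Qed.

Lemma morphism_iotaU : morphism (iotaU C).
Proof.
split=> [g t rt|x a b xab]; first by exists 1, t.
by rewrite act_iotaU; congr Some; apply/esym/iotaU_clsU_eq.
Qed.

Lemma globalization_iotaU : globalization (iotaU C).
Proof.
split; first exact: in_A_act_systemU.
- exact: morphism_iotaU.
- exact: iotaU_inj.
- move=> x a; rewrite act_iotaU; split.
    case xa: (act x a) => [b|//] _; exists b; congr Some.
    by apply/esym/iotaU_clsU_eq.
  by case=> b /Some_inj/esym/iotaU_clsU_eq ->.
- move=> g t [x [b [rb tb]]].
  apply: (hC.2 x g b t rb) => i; apply/iotaU_clsU_eq.
  by have := congr1 (fun s => tnth s i) tb; rewrite !tnth_map.
Qed.

Section Extension.
Context (D : act_system G T) (phi : C -> D).
Hypotheses (hD : in_A D) (hphi : morphism phi).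

Let thDP : partial_action (@act _ _ D) := hD.1.1.

Lemma global_defined (x : G) (d : D) : exists e, act x d = Some e.
Proof. by have := hD.2 x d; case: (act x d) => // e _; exists e. Qed.

(** This is what makes [x, a] |-> x (phi a) well defined. *)
Lemma act_phi_clsU (x y : G) (a b : C) :
  clsU (@act _ _ C) x a = clsU (@act _ _ C) y b ->
  act x (phi a) = act y (phi b).
Proof.
move=> /(eq_clsU thP); rewrite /simU /= => /hphi.2 xab.
have [c yc] := global_defined y (phi b).
by have := pactM thDP xab yc; rewrite mulVKg yc.
Qed.

Lemma extension_exists : exists psi : act_systemU C -> D,
  forall x a, act x (phi a) = Some (psi (clsU (@act _ _ C) x a)).
Proof.
suff /choice[psi psiP] : forall X : act_systemU C, exists d : D,
    forall x a, X = clsU (@act _ _ C) x a -> act x (phi a) = Some d.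
  by exists psi => x a; apply: psiP.
move=> X; have [y [b ->]] := AU_clsU X.
have [d yd] := global_defined y (phi b).
by exists d => x a /act_phi_clsU <-.
Qed.

Lemma extension_morphism (psi : act_systemU C -> D) :
  (forall x a, act x (phi a) = Some (psi (clsU (@act _ _ C) x a))) ->
  morphism psi.
Proof.
move=> psiP; split=> [g _ [x [a [ra ->]]]|x X _ [<-]].
  apply: (hD.1.2 x g (map_tuple phi a)); first exact: hphi.1.
  by move=> i; rewrite !tnth_map.
have [y [a ->]] := AU_clsU X; rewrite translate_clsU.
have [c xc] := global_defined x (psi (clsU (@act _ _ C) y a)).
by rewrite xc -(pactM thDP (psiP y a) xc) psiP.
Qed.

(** Equivariance carries the prescribed value at iota a to its x-translate
    [x, a]; this is the uniqueness half of the universal property. *)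
Lemma extension_forced (psi : act_systemU C -> D) :
  morphism psi -> psi \o iotaU C = phi ->
  forall x a, act x (phi a) = Some (psi (clsU (@act _ _ C) x a)).
Proof. by move=> hpsi <- x a; apply: hpsi.2; apply: act_iotaU. Qed.

Lemma extension_unique_exists :
  exists! psi : act_systemU C -> D, morphism psi /\ psi \o iotaU C = phi.
Proof.
have [psi psiP] := extension_exists.
exists psi; split=> [|psi' [hpsi' /(extension_forced hpsi') psi'P]].
  split; first exact: extension_morphism.
  by apply: funext => a; have := psiP 1 a; rewrite (pact1 thDP) => -[].
apply: funext => X; have [x [a ->]] := AU_clsU X.
by have := psiP x a; rewrite psi'P => -[].
Qed.

End Extension.

Lemma reflector_iotaU : reflector C (act_systemU C) (iotaU C).
Proof.
split; [exact: in_A_act_systemU | exact: morphism_iotaU |].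
by move=> D phi hD hphi; apply: extension_unique_exists.
Qed.

End Objects.

Theorem theorem2p4 (G : groupType) (T : rel_type) (A : rel_system T)
    (theta : G -> A -> option A) (hA : in_pA (ActSystem theta)) :
  universal_globalization (ActSystem theta)
    (act_systemU (ActSystem theta)) (iotaU (ActSystem theta)) /\
  reflector (ActSystem theta)
    (act_systemU (ActSystem theta)) (iotaU (ActSystem theta)).
Proof.
have refl := reflector_iotaU hA.
split=> //; split=> [|B' iota' [hB' hiota' _ _ _]].
  exact: globalization_iotaU.
have [_ _ /(_ _ _ hB' hiota')[kappa [[hk ek] uk]]] := refl.
exists kappa; split=> [|kappa' [hk' ek']]; first by split.
by apply: uk; split.
Qed.
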